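(* Let $I\subseteq(0,\infty)$ be an interval, $M\ge 0$, let $f:I\to\mathbb{R}$ be an $M$-Lipschitzian function on $I$, and let $a,b\in I$ with $a<b$. Then for all $x\in[a,b]$, $\lambda\in[0,1]$ and $\alpha>0$, $$|I_f(x,\lambda,\alpha,a,b)|\le M\Big\{\big[(1-\lambda)x-\lambda a\big]\Big(\ln\frac{x}{a}\Big)^{\alpha}+\alpha(2\lambda-1)\int_a^x\Big(\ln\frac{t}{a}\Big)^{\alpha-1}dt+\big[\lambda b-(1-\lambda)x\big]\Big(\ln\frac{b}{x}\Big)^{\alpha}+\alpha(1-2\lambda)\int_x^b\Big(\ln\frac{b}{t}\Big)^{\alpha-1}dt\Big\}.$$
   Context: A function $f:I\to\mathbb{R}$ is $M$-Lipschitzian on $I$ ($M\ge0$) if $|f(u)-f(v)|\le M|u-v|$ for all $u,v\in I$. For $\alpha>0$ and $c\in[a,b]$ the Hadamard fractional integrals used are $$J_{c-}^{\alpha}f(a)=\frac{1}{\Gamma(\alpha)}\int_a^c\Big(\ln\frac{t}{a}\Big)^{\alpha-1}f(t)\frac{dt}{t},\qquad J_{c+}^{\alpha}f(b)=\frac{1}{\Gamma(\alpha)}\int_c^b\Big(\ln\frac{b}{t}\Big)^{\alpha-1}f(t)\frac{dt}{t},$$ (equal to $0$ when the interval of integration is a point), where $\Gamma$ is the Euler Gamma function. The notation $\ln^\alpha u$ means $(\ln u)^\alpha$, with $0^\alpha=0$. Define $$I_f(x,\lambda,\alpha,a,b)=(1-\lambda)\Big[\ln^{\alpha}\frac{x}{a}+\ln^{\alpha}\frac{b}{x}\Big]f(x)+\lambda\Big[f(a)\ln^{\alpha}\frac{x}{a}+f(b)\ln^{\alpha}\frac{b}{x}\Big]-\Gamma(\alpha+1)\big[J_{x-}^{\alpha}f(a)+J_{x+}^{\alpha}f(b)\big].$$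 *)

(* Defs.v *)
From HB Require Import structures.
From mathcomp Require Import all_boot all_order all_algebra.
From mathcomp Require Import all_classical all_reals all_analysis.

Set Implicit Arguments.
Unset Strict Implicit.
Unset Printing Implicit Defensive.

Import Order.TTheory GRing.Theory Num.Theory.
Import numFieldNormedType.Exports.

Local Open Scope classical_set_scope.
Local Open Scope ring_scope.

Definition Gamma (R : realType) (alpha : R) : R :=
  \int[lebesgue_measure]_(t in `]0, +oo[) (t `^ (alpha - 1) * expR (- t)).

(* [hadamard_right f alpha c a] is $J_{c-}^\alpha f(a)$ for $a \le c$. *)
Definition hadamard_right (R : realType) (f : R -> R) (alpha c a : R) : R :=
  (Gamma alpha)^-1 *
  \int[lebesgue_measure]_(t in `[a, c]) (ln (t / a) `^ (alpha - 1) * f t / t).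

(* [hadamard_left f alpha c b] is $J_{c+}^\alpha f(b)$ for $c \le b$. *)
Definition hadamard_left (R : realType) (f : R -> R) (alpha c b : R) : R :=
  (Gamma alpha)^-1 *
  \int[lebesgue_measure]_(t in `[c, b]) (ln (b / t) `^ (alpha - 1) * f t / t).

Definition I_ (R : realType) (f : R -> R) (x lambda alpha a b : R) : R :=
  (1 - lambda) * (ln (x / a) `^ alpha + ln (b / x) `^ alpha) * f x
  + lambda * (f a * ln (x / a) `^ alpha + f b * ln (b / x) `^ alpha)
  - Gamma (alpha + 1)
    * (hadamard_right f alpha x a + hadamard_left f alpha x b).

(* Main.v *)
Require Import Defs.
From HB Require Import structures.
From mathcomp Require Import all_boot all_order all_algebra.
From mathcomp Require Import all_classical all_reals all_analysis.
From mathcomp Require Import measurable_realfun ring lra.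

Import Order.TTheory GRing.Theory Num.Theory.
Import numFieldNormedType.Exports.

Local Open Scope classical_set_scope.
Local Open Scope ring_scope.

(** The functional [I_] splits at [x] into a left and a right contribution. On
    the left, the weight [w t = ln (t / a) ^ (alpha - 1) / t] satisfies
    [alpha * \int_a^x w = ln (x / a) ^ alpha], and [Gamma (alpha + 1)] divided by
    [Gamma alpha] is [alpha], so that the contribution is
    [alpha * \int_a^x w t * ((1 - lambda) * (f x - f t) + lambda * (f a - f t))].
    The Lipschitz condition bounds the absolute value of the integrand by
    [M * w t * ((1 - lambda) * (x - t) + lambda * (t - a))], and the integral of
    this bound is the left half of the right-hand side, because [w t * t] is
    [ln (t / a) ^ (alpha - 1)]. The right contribution is symmetric. This is
    [lipschitz_weighted_deviation], specialized in [fractional_left_bound] and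
    [fractional_right_bound].

    Two facts need improper integrals. The weights are unbounded at an end point
    for [alpha < 1], so their integrability and their integral come from a
    fundamental theorem of calculus on open intervals, proved by exhaustion
    ([ge0_FTC2_oo]). The functional equation [GammaD1] comes from the same
    exhaustion on ]0, +oo[; it must be complemented by the finiteness and
    positivity of [Gamma alpha] ([Gamma_integrable], [Gamma_gt0]), since
    [Gamma alpha] has to be cancelled. *)

Section fractional_bound.
Context {R : realType}.
Notation mu := (@lebesgue_measure R).

(** * Improper fundamental theorem of calculus *)

(** Continuity of the integral along an increasing union, for an integrable
    function of any sign: the positive and negative parts are treated apart. *)
Lemma cvg_integral_nondecreasing_set d (T : measurableType d)
    (nu : {measure set T -> \bar R}) (S : (set T)^nat) (f : T -> \bar R) :
  nondecreasing_seq S -> (forall n, measurable (S n)) ->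
  nu.-integrable (\bigcup_n S n) f ->
  (\int[nu]_(x in S n) f x)%E @[n --> \oo]
    --> (\int[nu]_(x in \bigcup_n S n) f x)%E.
Proof.
move=> ndS mS intf.
have mU : measurable (\bigcup_n S n) by exact: bigcup_measurable.
have mf n : measurable_fun (S n) f.
  exact: (measurable_funS mU (bigcup_sup _) (measurable_int nu intf)).
rewrite integralE; under eq_cvg do rewrite integralE.
apply: cvgeB.
- by apply: fin_num_adde_defl; rewrite fin_numN; exact: integrable_neg_fin_num.
- apply: ge0_nondecreasing_set_cvg_integral => // n.
  exact: measurable_funepos.
- apply: ge0_nondecreasing_set_cvg_integral => // n.
  exact: measurable_funeneg.
Qed.

(** The fundamental theorem of calculus on a set [D] exhausted by the segments
    [[u n, v n]]. No sign and no integrability is required: the only assumption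
    on the integral is that the integrals over the segments converge to it. *)
Section exhaustion.
Variables (f F : R -> R) (u v : R^nat) (A B : R).
Let D := \bigcup_n `[u n, v n]%classic.
Hypothesis uv : forall n, u n < v n.
Hypothesis dF : forall t, D t -> is_derive t 1 F (f t).
Hypothesis cf : forall t, D t -> {for t, continuous f}.
Hypothesis Fu : F (u n) @[n --> \oo] --> A.
Hypothesis Fv : F (v n) @[n --> \oo] --> B.

Lemma FTC2_exhaustion :
  (\int[mu]_(t in `[u n, v n]) (f t)%:E)%E @[n --> \oo]
    --> (\int[mu]_(t in D) (f t)%:E)%E ->
  (\int[mu]_(t in D) (f t)%:E = (B - A)%:E)%E.
Proof.
move=> lim1; apply: cvg_unique lim1 _ => //.
have E n : (\int[mu]_(t in `[u n, v n]) (f t)%:E = (F (v n) - F (u n))%:E)%E.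
  have sub t : `[u n, v n]%classic t -> D t by move=> ?; exists n.
  have cF : {within `[u n, v n], continuous F}.
    apply: derivable_within_continuous => t tuv.
    by have [] := dF _ (sub _ tuv).
  rewrite (@continuous_FTC2 _ f F)//.
  - by apply: continuous_in_subspaceT => t /set_mem /sub /cf.
  - move/(continuous_within_itvP _ (uv n)) : cF => [_ Fl Fr]; split => //.
    move=> t /subset_itv_oo_cc tuv.
    by have [] := dF _ (sub _ tuv).
  - move=> t /subset_itv_oo_cc tuv; rewrite derive1E.
    by have [_] := dF _ (sub _ tuv).
rewrite (funext E).
apply: cvg_EFin; first exact: nearW.
exact: cvgB.
Qed.
End exhaustion.

Lemma bigcup_itvcc_oo (c d : R) (u v : R^nat) :
  (forall n, c < u n) -> (forall n, v n < d) ->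
  u n @[n --> \oo] --> c -> v n @[n --> \oo] --> d ->
  \bigcup_n `[u n, v n]%classic = `]c, d[%classic.
Proof.
move=> cu vd uc ud; apply/seteqP; split => [t [n _]|t] /=.
  by rewrite !in_itv/= => /andP[ut tv];
    rewrite (lt_le_trans (cu n))// (le_lt_trans tv).
rewrite in_itv/= => /andP[ct td].
near \oo => n; exists n => //=; rewrite in_itv/=; apply/andP; split; near: n.
- exact: cvgr_le uc _ ct.
- exact: cvgr_ge ud _ td.
Unshelve. all: by end_near. Qed.

(** An improper fundamental theorem of calculus: [f >= 0] is only controlled on
    the open interval, and may be unbounded at both ends, where the primitive
    [F] has limits [A] and [B]. The values [f c] and [f d] are arbitrary. *)
Section bounded.
Variables (f F : R -> R) (c d A B : R).
Hypothesis cd : c < d.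
Hypothesis dF : forall t, c < t < d -> is_derive t 1 F (f t).
Hypothesis cf : forall t, c < t < d -> {for t, continuous f}.
Hypothesis Fc : F t @[t --> c^'+] --> A.
Hypothesis Fd : F t @[t --> d^'-] --> B.
Hypothesis f0 : forall t, c < t < d -> 0 <= f t.

Let mf : measurable_fun `]c, d[ f.
Proof.
apply: open_continuous_measurable_fun => // t /set_mem/=.
by rewrite in_itv/=; exact: cf.
Qed.

Lemma ge0_FTC2_oo : (\int[mu]_(t in `[c, d]) (f t)%:E = (B - A)%:E)%E.
Proof.
(* [c + w n] and [d - w n] are the ends of the exhausting segments; the factor
   [1 / 2] keeps them apart. *)
pose w n : R := (d - c) * (n.+2%:R)^-1 / 2.
have w0 n : 0 < w n by rewrite /w divr_gt0// mulr_gt0// ?subr_gt0// invr_gt0.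
have w_lt n : w n < (d - c) / 2.
  by rewrite /w ltr_pM2r// gtr_pMr ?subr_gt0// invf_lt1// ltr1n.
have w_ni : nonincreasing_seq w.
  move=> m n mn; rewrite /w ler_pM2r// ler_pM2l ?subr_gt0// lef_pV2 ?posrE//.
  by rewrite ler_nat.
have w_cvg : w n @[n --> \oo] --> 0.
  rewrite (_ : 0 = (d - c) * 0 / 2); last by rewrite mulr0 mul0r.
  apply: cvgMr_tmp; apply: cvgMl_tmp.
  by have := @cvg_harmonic R; rewrite -(cvg_shiftS (@harmonic R)).
pose u n := c + w n; pose v n := d - w n.
have cu n : c < u n by rewrite /u ltrDl.
have vd n : v n < d by rewrite /v ltrBlDr ltrDl.
have uv n : u n < v n by rewrite /u /v; have := w_lt n; lra.
have uc : u n @[n --> \oo] --> c.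
  by rewrite -[X in _ --> X]addr0; apply: cvgD => //; exact: cvg_cst.
have vdc : v n @[n --> \oo] --> d.
  by rewrite -[X in _ --> X]subr0; apply: cvgB => //; exact: cvg_cst.
have uvE := bigcup_itvcc_oo _ _ _ _ cu vd uc vdc.
rewrite integral_itv_bndoo; last exact/measurable_EFinP.
rewrite -uvE; apply: (FTC2_exhaustion f F u v A B uv).
- by rewrite uvE => t /=; rewrite in_itv/=; exact: dF.
- by rewrite uvE => t /=; rewrite in_itv/=; exact: cf.
- by apply: ((cvg_at_rightP F c A).1 Fc); split.
- by apply: ((cvg_at_leftP F d B).1 Fd); split.
apply: ge0_nondecreasing_set_cvg_integral => //.
- move=> m n mn; rewrite subsetEset; apply: subset_itv; rewrite bnd_simp.
  + by rewrite /u lerD2l w_ni.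
  + by rewrite /v lerD2l lerN2 w_ni.
- move=> n; apply/measurable_EFinP; apply: measurable_funS mf => //.
  by rewrite -uvE => t tn; exists n.
- move=> n t unt; rewrite lee_fin f0//.
  have : `]c, d[%classic t by rewrite -uvE; exists n.
  by rewrite /= in_itv.
Qed.

(** Integrability comes for free from the finiteness of the integral. *)
Lemma ge0_FTC2_oo_integrable : mu.-integrable `[c, d] (EFin \o f).
Proof.
have mf' : measurable_fun `[c, d] f by exact: measurable_fun_itv_cc mf.
apply/integrableP; split; first exact/measurable_EFinP.
rewrite integral_itv_bndoo; last first.
  by apply: measurableT_comp => //; exact/measurable_EFinP.
rewrite [X in (X < _)%E](_ : _ = (\int[mu]_(t in `]c, d[) (f t)%:E)%E).
  rewrite -(integral_itv_bndoo true false); last exact/measurable_EFinP.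
  by rewrite ge0_FTC2_oo ltry.
apply: eq_integral => t /set_mem/=; rewrite in_itv/= => /f0 ft0.
by rewrite ger0_norm.
Qed.
End bounded.

(** * Powers of logarithms as primitives *)

(** Continuity of a positive power along a nonnegative function. The sign
    matters when [l = 0], since [x `^ p = 1] for [x < 0]. *)
Lemma cvg_powR {T} {F : set_system T} {FF : Filter F} (g : T -> R) (l p : R) :
  0 < p -> 0 <= l -> (\forall t \near F, 0 <= g t) ->
  g t @[t --> F] --> l -> g t `^ p @[t --> F] --> l `^ p.
Proof.
move=> p0; rewrite le_eqVlt => /predU1P[<- g0 gl|l0 _ gl]; last first.
  apply: (@cvg_comp _ _ _ g (fun r => r `^ p) F (nbhs l)); first exact: gl.
  have dp : derivable (fun r => r `^ p) l 1.
    by apply: derivable_powR; rewrite in_itv/= l0.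
  have cp : {for l, continuous (fun r => r `^ p)}.
    exact/differentiable_continuous/derivable1_diffP.
  exact: cp.
rewrite powR0 ?gt_eqF//; apply/cvgrPdist_lt => e e0.
have /cvgrPdist_lt/(_ e e0)[d /= d0 pe] := @powR_cvg0 R p p0.
have /cvgrPdist_lt/(_ d d0) gd := gl.
near=> t.
have [gt0|] := ltP 0 (g t).
  by apply: pe => //; rewrite /ball/=; near: t.
have : 0 <= g t by near: t.
move=> g0' g0''; have -> : g t = 0 by apply/eqP; rewrite eq_le g0''.
by rewrite powR0 ?gt_eqF// subrr normr0.
Unshelve. all: by end_near. Qed.

Lemma is_derive_comp_powR (g : R -> R) (t dg p : R) : 0 < g t ->
  is_derive t 1 g dg ->
  is_derive t 1 (fun r => g r `^ p) (p * g t `^ (p - 1) * dg).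
Proof.
move=> g0 dg1.
exact: (@is_derive1_comp R (fun r => r `^ p) g _ _ _
  (@is_derive1_powR R p (g t) g0) dg1).
Qed.

Lemma is_derive_ln_div (a t : R) : 0 < a -> 0 < t ->
  is_derive t 1 (fun r => ln (r / a)) t^-1.
Proof.
move=> a0 t0.
have d1 : is_derive t 1 (fun r : R => r / a) a^-1.
  have := @is_deriveM R R id (cst a^-1) t 1 1 0
    (is_derive_id _ _) (is_derive_cst _ _ _).
  by rewrite scaler0 add0r [X in is_derive _ _ _ X]mulr1.
have := @is_derive1_comp R (@ln R) (fun r => r / a) t _ _
  (is_derive1_ln (divr_gt0 t0 a0)) d1.
rewrite (_ : (t / a)^-1 * a^-1 = t^-1)//.
by rewrite invf_div mulrAC divff ?mul1r// gt_eqF.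
Qed.

Lemma is_derive_ln_div_swap (b t : R) : 0 < b -> 0 < t ->
  is_derive t 1 (fun r => ln (b / r)) (- t^-1).
Proof.
move=> b0 t0.
have t_neq0 : t != 0 by rewrite gt_eqF.
have d1 : is_derive t 1 (fun r : R => b / r) (- (b / t ^+ 2)).
  have := @is_deriveM R R (cst b) (fun r => r^-1) t 1 0 _
    (is_derive_cst _ _ _) (is_deriveV t_neq0 (is_derive_id _ _)).
  rewrite scaler0 addr0/=.
  by rewrite /GRing.scale/= mulr1 mulrN.
have := @is_derive1_comp R (@ln R) (fun r => b / r) t _ _
  (is_derive1_ln (divr_gt0 b0 t0)) d1.
rewrite (_ : (b / t)^-1 * _ = - t^-1)//.
have b_neq0 : b != 0 by rewrite gt_eqF.
by field; rewrite b_neq0 t_neq0.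
Qed.

Lemma is_derive_continuous (g : R -> R) (t dg : R) :
  is_derive t 1 g dg -> {for t, continuous g}.
Proof. by case=> dg1 _; exact/differentiable_continuous/derivable1_diffP. Qed.

(** The weight [g ^ (p - 1) / t], where [g' = s / t] with [s = 1] or [s = -1], so
    that [s / p * g ^ p] is a primitive; here [g] is [ln (t / a)] or [ln (b / t)].
    The weight is unbounded where [g] vanishes as soon as [p < 1]. *)
Section log_weight.
Variables (g : R -> R) (c d gc gd s p : R).
Hypotheses (c0 : 0 < c) (cd : c < d) (p0 : 0 < p) (s2 : s * s = 1).
Hypotheses (gc0 : 0 <= gc) (gd0 : 0 <= gd).
Hypothesis g0 : forall t, c < t < d -> 0 < g t.
Hypothesis dg : forall t, c < t < d -> is_derive t 1 g (s * t^-1).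
Hypothesis gcE : g t @[t --> c^'+] --> gc.
Hypothesis gdE : g t @[t --> d^'-] --> gd.

Let f t := g t `^ (p - 1) / t.
Let F t := s / p * g t `^ p.

Let t_gt0 t : c < t < d -> 0 < t.
Proof. by move=> /andP[ct _]; exact: lt_trans ct. Qed.

Let dF t : c < t < d -> is_derive t 1 F (f t).
Proof.
move=> tcd; have t0 := t_gt0 t tcd.
have := @is_deriveZ R R R _ (s / p) t 1 _
  (is_derive_comp_powR g t _ p (g0 t tcd) (dg t tcd)).
rewrite (_ : _ *: _ = f t)// /f /GRing.scale/=.
transitivity (s * s * (g t `^ (p - 1) / t)); last by rewrite s2 mul1r.
by field; rewrite !gt_eqF.
Qed.

Let cf t : c < t < d -> {for t, continuous f}.
Proof.
move=> tcd; apply: continuousM.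
  exact: is_derive_continuous
    (is_derive_comp_powR g t _ (p - 1) (g0 t tcd) (dg t tcd)).
by apply: continuousV; [rewrite gt_eqF ?t_gt0|exact: cvg_id].
Qed.

Let f0 t : c < t < d -> 0 <= f t.
Proof. by move=> tcd; rewrite divr_ge0 ?powR_ge0 ?ltW ?t_gt0. Qed.

Let Fc : F t @[t --> c^'+] --> s / p * gc `^ p.
Proof.
apply: cvgMl_tmp; apply: cvg_powR => //.
near=> t; apply/ltW/g0/andP; split; near: t.
  exact: nbhs_right_gt.
exact: nbhs_right_lt.
Unshelve. all: by end_near. Qed.

Let Fd : F t @[t --> d^'-] --> s / p * gd `^ p.
Proof.
apply: cvgMl_tmp; apply: cvg_powR => //.
near=> t; apply/ltW/g0/andP; split; near: t.
  exact: nbhs_left_gt.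
exact: nbhs_left_lt.
Unshelve. all: by end_near. Qed.

Lemma log_weight_integrable :
  mu.-integrable `[c, d] (fun t => (g t `^ (p - 1) / t)%:E).
Proof. exact: ge0_FTC2_oo_integrable cd dF cf Fc Fd f0. Qed.

Lemma log_weight_integral :
  p * (\int[mu]_(t in `[c, d]) (g t `^ (p - 1) / t)) = s * (gd `^ p - gc `^ p).
Proof.
rewrite /Rintegral (ge0_FTC2_oo _ _ _ _ _ _ cd dF cf Fc Fd f0)/=.
by field; rewrite gt_eqF.
Qed.
End log_weight.

Lemma is_derive_cvg_at_sides (g : R -> R) (t dg : R) :
  is_derive t 1 g dg -> g r @[r --> t^'+] --> g t /\ g r @[r --> t^'-] --> g t.
Proof.
move=> /is_derive_continuous gt.
by split; [apply: cvg_at_right_filter|apply: cvg_at_left_filter].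
Qed.

Lemma log_weight_left (a x p : R) : 0 < a -> a < x -> 0 < p ->
  mu.-integrable `[a, x] (fun t => (ln (t / a) `^ (p - 1) / t)%:E) /\
  p * (\int[mu]_(t in `[a, x]) (ln (t / a) `^ (p - 1) / t)) = ln (x / a) `^ p.
Proof.
move=> a0 ax p0; have x0 := lt_trans a0 ax.
have g0 t : a < t < x -> 0 < ln (t / a).
  by move=> /andP[at_ _]; rewrite ln_gt0// ltr_pdivlMr// mul1r.
have dg t : a < t < x -> is_derive t 1 (fun r => ln (r / a)) (1 * t^-1).
  by move=> /andP[at_ _]; rewrite mul1r; apply: is_derive_ln_div => //;
    exact: lt_trans at_.
have [ga _] := is_derive_cvg_at_sides _ _ _ (is_derive_ln_div a a a0 a0).
have [_ gx] := is_derive_cvg_at_sides _ _ _ (is_derive_ln_div a x a0 x0).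
rewrite divff ?gt_eqF// ln1 in ga.
have gx0 : 0 <= ln (x / a) by rewrite ln_ge0// ler_pdivlMr// mul1r ltW.
split; first exact: (log_weight_integrable _ _ _ _ _ 1 p
  a0 ax p0 (mulr1 _) _ gx0 g0 dg ga gx).
rewrite (log_weight_integral _ _ _ _ _ 1 p
  a0 ax p0 (mulr1 _) _ gx0 g0 dg ga gx)//.
by rewrite mul1r powR0 ?subr0// gt_eqF.
Qed.

Lemma log_weight_right (b x p : R) : 0 < x -> x < b -> 0 < p ->
  mu.-integrable `[x, b] (fun t => (ln (b / t) `^ (p - 1) / t)%:E) /\
  p * (\int[mu]_(t in `[x, b]) (ln (b / t) `^ (p - 1) / t)) = ln (b / x) `^ p.
Proof.
move=> x0 xb p0; have b0 := lt_trans x0 xb.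
have g0 t : x < t < b -> 0 < ln (b / t).
  by move=> /andP[xt tb]; rewrite ln_gt0// ltr_pdivlMr ?mul1r// (lt_trans x0).
have dg t : x < t < b -> is_derive t 1 (fun r => ln (b / r)) (-1 * t^-1).
  by move=> /andP[xt _]; rewrite mulN1r; apply: is_derive_ln_div_swap => //;
    exact: lt_trans xt.
have [gx _] := is_derive_cvg_at_sides _ _ _ (is_derive_ln_div_swap b x b0 x0).
have [_ gb] := is_derive_cvg_at_sides _ _ _ (is_derive_ln_div_swap b b b0 b0).
rewrite divff ?gt_eqF// ln1 in gb.
have gx0 : 0 <= ln (b / x) by rewrite ln_ge0// ler_pdivlMr// mul1r ltW.
have N1 : -1 * -1 = 1 :> R by rewrite mulrNN mulr1.
split; first exact: (log_weight_integrable _ _ _ _ _ (-1) p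
  x0 xb p0 N1 gx0 _ g0 dg gx gb).
rewrite (log_weight_integral _ _ _ _ _ (-1) p
  x0 xb p0 N1 gx0 _ g0 dg gx gb)//.
by rewrite mulN1r powR0 ?sub0r ?opprK// gt_eqF.
Qed.

(** * The Gamma function *)

Section gamma.
Implicit Types p q t : R.

(** The bound [x ^ n.+1 / n.+1`! <= expR x], taken at [x = t / 2] with
    [q <= n.+1], shows that half of the exponential decay absorbs any power. *)
Lemma powR_expRN_le q : exists2 C : R, 0 <= C &
  forall t, 1 <= t -> t `^ q * expR (- t) <= C * expR (- 2^-1 * t).
Proof.
pose n := Num.trunc q; exists (2 ^+ n.+1 * (n.+1)`!%:R) => [|t t1].
  by rewrite mulr_ge0// exprn_ge0.
have t0 : 0 <= t by rewrite (le_trans ler01).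
have -> : - t = - 2^-1 * t + - (t / 2) by field.
rewrite expRD mulrCA mulrC ler_pM2r ?expR_gt0// expRN.
rewrite ler_pdivrMr ?expR_gt0//.
apply: (@le_trans _ _ (t ^+ n.+1)).
  rewrite -powR_mulrn//; apply: ler_powR => //.
  exact/ltW/Num.Theory.truncnS_gt.
have t20 : 0 <= t / 2 by rewrite divr_ge0.
have := expR_ge1Dxn n t20.
have fact0 : 0 < n.+1`!%:R :> R by rewrite ltr0n fact_gt0.
have pow0 : 0 < 2 ^+ n.+1 :> R by rewrite exprn_gt0.
set e := expR _; rewrite expr_div_n => le_e.
have : t ^+ n.+1 / 2 ^+ n.+1 / n.+1`!%:R <= e by lra.
by rewrite ler_pdivrMr// ler_pdivrMr// => /le_trans; apply; lra.
Qed.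

(* The integrand of [Gamma p]. *)
Let gam p t := t `^ (p - 1) * expR (- t).

Let measurable_gam p : measurable_fun setT (gam p).
Proof.
apply: measurable_funM; first exact: measurable_powR.
by apply: measurableT_comp => //; exact: measurable_expR.
Qed.

Let gam_ge0 p t : 0 <= gam p t.
Proof. by rewrite mulr_ge0// ?powR_ge0// expR_ge0. Qed.

Let powR_unit_itv p : 0 < p ->
  mu.-integrable `]0, 1] (fun t => (t `^ (p - 1))%:E) /\
  \int[mu]_(t in `]0, 1]) (t `^ (p - 1)) = p^-1.
Proof.
move=> p0; pose F t := p^-1 * t `^ p.
have dF t : 0 < t < 1 -> is_derive t 1 F (t `^ (p - 1)).
  move=> /andP[t0 _].
  have := @is_deriveZ R R R _ (p^-1) t 1 _ (@is_derive1_powR R p t t0).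
  by rewrite [X in is_derive _ _ _ X](_ : _ = t `^ (p - 1))//
    /GRing.scale/= mulKf// gt_eqF.
have cf t : 0 < t < 1 -> {for t, continuous (fun r => r `^ (p - 1))}.
  move=> /andP[t0 _].
  exact: is_derive_continuous (@is_derive1_powR R (p - 1) t t0).
have F0 : F t @[t --> 0^'+] --> 0.
  by rewrite -[X in _ --> X](mulr0 p^-1); apply: cvgMl_tmp; exact: powR_cvg0.
have F1 : F t @[t --> 1^'-] --> p^-1.
  rewrite (_ : p^-1 = F 1) /F; last by rewrite powR1 mulr1.
  apply: cvgMl_tmp.
  exact: (is_derive_cvg_at_sides _ _ _ (@is_derive1_powR R p 1 ltr01)).2.
have f0 t : 0 < t < 1 -> 0 <= t `^ (p - 1) by move=> _; exact: powR_ge0.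
have i01 : mu.-integrable `]0, 1] (fun t => (t `^ (p - 1))%:E).
  apply: integrableS
    (ge0_FTC2_oo_integrable _ _ _ _ _ _ ltr01 dF cf F0 F1 f0) => //.
  by apply: subset_itvr; rewrite bnd_simp.
split => //; rewrite Rintegral_itv_obnd_cbnd//.
by rewrite /Rintegral (ge0_FTC2_oo _ _ _ _ _ _ ltr01 dF cf F0 F1 f0)/= subr0.
Qed.

(** The integrand is dominated by [t ^ (p - 1)] on ]0, 1] and by a multiple of
    [expR (- t / 2)], a multiple of an exponential density, on ]1, +oo[. *)
Lemma Gamma_integrable p : 0 < p ->
  mu.-integrable `]0, +oo[ (fun t => (t `^ (p - 1) * expR (- t))%:E).
Proof.
move=> p0.
have i01 : mu.-integrable `]0, 1] (EFin \o gam p).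
  apply: le_integrable (powR_unit_itv p p0).1 => //.
  - by apply/measurable_EFinP; exact: (measurable_funTS (measurable_gam p)).
  - move=> t /=; rewrite in_itv/= => /andP[t0 _].
    rewrite lee_fin !ger0_norm ?powR_ge0//.
    by rewrite ler_piMr ?powR_ge0// expR_le1 oppr_le0 ltW.
have i1y : mu.-integrable `]1, +oo[ (EFin \o gam p).
  have [C C0 Cle] := powR_expRN_le (p - 1).
  have h0 : 0 < 2^-1 :> R by rewrite invr_gt0.
  have iexp : mu.-integrable `]1, +oo[ (EFin \o exponential_pdf 2^-1).
    exact: integrableS (integrable_exponential_pdf h0).
  apply: le_integrable (integrableZl _ (2 * C) iexp) => //.
    by apply/measurable_EFinP; exact: (measurable_funTS (measurable_gam p)).
  move=> t /=; rewrite in_itv/= andbT => t1.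
  rewrite lee_fin ger0_norm// (le_trans (Cle t (ltW t1)))//.
  rewrite exponential_pdfE ?(le_trans ler01 (ltW t1))//=.
  by apply: le_trans (ler_norm _); rewrite mulrACA divff// mul1r.
have -> : `]0, +oo[%classic = `]0, 1] `|` `]1, +oo[ :> set R.
  by rewrite -itv_bndbnd_setU// bnd_simp.
apply/integrableP; split.
  by apply/measurable_EFinP; exact: (measurable_funTS (measurable_gam p)).
rewrite ge0_integral_setU//=.
- move: i01 i1y => /integrableP[_ i01] /integrableP[_ i1y].
  exact: lte_add_pinfty.
- apply: (@measurableT_comp _ _ _ _ _ _ abse _ (EFin \o gam p)) => //.
  by apply/measurable_EFinP; exact: (measurable_funTS (measurable_gam p)).
- apply/disj_setPS => t [] /=; rewrite !in_itv/= andbT => /andP[_ t1].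
  by rewrite ltNge t1.
Qed.

(** On ]0, 1] the integrand is at least [expR (-1) * t ^ (p - 1)], hence
    [Gamma p >= expR (-1) / p]. *)
Lemma Gamma_gt0 p : 0 < p -> 0 < Gamma p.
Proof.
move=> p0; have ip := Gamma_integrable p p0.
have [i1 I1] := powR_unit_itv p p0.
have sub : `]0, (1 : R)]%classic `<=` `]0, +oo[%classic by apply: subset_itvl.
have i01 : mu.-integrable `]0, 1] (EFin \o gam p) by exact: integrableS ip.
apply: (@lt_le_trans _ _ (expR (- 1) / p)); first by rewrite divr_gt0// expR_gt0.
apply: (@le_trans _ _ (\int[mu]_(t in `]0, 1]) gam p t)).
  rewrite -I1 -RintegralZl//; apply: le_Rintegral => //.
    exact: integrableZl i1.
  move=> t /=; rewrite in_itv/= => /andP[t0 t1].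
  by rewrite /gam mulrC ler_wpM2l ?powR_ge0// ler_expR lerN2.
apply: fine_le.
- exact: integrable_fin_num.
- exact: integrable_fin_num.
apply: ge0_subset_integral => //.
  by apply/measurable_EFinP; exact: (measurable_funTS (measurable_gam p)).
by move=> t _; rewrite lee_fin; exact: gam_ge0.
Qed.

(** Integration by parts, read as: the integrable function
    [t ^ p * expR (- t) - p * t ^ (p - 1) * expR (- t)] has the primitive
    [- t ^ p * expR (- t)], which vanishes at both ends of ]0, +oo[. *)
Lemma GammaD1 p : 0 < p -> Gamma (p + 1) = p * Gamma p.
Proof.
move=> p0.
have p10 : 0 < p + 1 by rewrite ltr_wpDr.
have i0 := Gamma_integrable p p0.
have i1 := Gamma_integrable (p + 1) p10.
rewrite addrK in i1.
pose D : set R := `]0, +oo[%classic.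
pose f t := t `^ p * expR (- t) - p * (t `^ (p - 1) * expR (- t)).
pose F t := - (t `^ p * expR (- t)).
have ip : mu.-integrable D (fun t => (p * (t `^ (p - 1) * expR (- t)))%:E).
  exact: integrableZl i0.
have dF t : D t -> is_derive t 1 F (f t).
  rewrite /D/= in_itv/= andbT => t0.
  have dE : is_derive t 1 (fun r => expR (- r)) (- expR (- t)).
    have := @is_derive1_comp R expR (fun r => - r) t _ _
      (is_derive_expR (- t)) (is_deriveNid _ _).
    by rewrite mulrN1.
  have := @is_deriveN R R R _ t 1 _
    (@is_deriveM R R (fun r => r `^ p) _ t 1 _ _ (@is_derive1_powR R p t t0) dE).
  rewrite [X in is_derive _ _ _ X](_ : _ = f t)// /f /GRing.scale/=.
  by ring.
have cf t : D t -> {for t, continuous f}.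
  rewrite /D/= in_itv/= andbT => t0.
  have cE : {for t, continuous (fun r : R => expR (- r))}.
    by apply: continuous_comp; [exact: continuousN|exact: continuous_expR].
  apply: continuousB; first apply: continuousM => //.
    exact: is_derive_continuous (@is_derive1_powR R p t t0).
  apply: continuousM; first exact: cst_continuous.
  apply: continuousM => //.
  exact: is_derive_continuous (@is_derive1_powR R (p - 1) t t0).
pose u n : R := n.+2%:R^-1.
pose v n : R := n.+2%:R.
have uv n : u n < v n.
  by rewrite /u /v (@lt_trans _ _ 1)// ?invf_lt1// ltr1n.
have u0 : u n @[n --> \oo] --> 0.
  by have := @cvg_harmonic R; rewrite -(cvg_shiftS (@harmonic R)).
have vy : v n @[n --> \oo] --> +oo%R.
  have := @cvgr_idn R; rewrite -(cvg_shiftn 2) /v.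
  by under eq_fun do rewrite addn2.
have DE : \bigcup_n `[u n, v n]%classic = D.
  apply/seteqP; split => [t [n _]|t] /=.
    rewrite /D/= !in_itv/= andbT => /andP[+ _]; apply: lt_le_trans.
    by rewrite invr_gt0.
  rewrite /D/= in_itv/= andbT => t0.
  near \oo => n; exists n => //=; rewrite in_itv/=; apply/andP; split; near: n.
    exact: cvgr_le u0 _ t0.
  exact: (cvgry_ge vy).
have Fu : F (u n) @[n --> \oo] --> 0.
  rewrite -[X in _ --> X]oppr0 -(mul0r (expR (- 0))); apply: cvgN; apply: cvgM.
    have p00 : 0 `^ p = 0 :> R by rewrite powR0// gt_eqF.
    rewrite -[X in _ --> X]p00; apply: cvg_powR => //.
    by apply: nearW => n; rewrite invr_ge0.
  apply: continuous_cvg; first exact: continuous_expR.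
  exact: cvgN.
have Fv : F (v n) @[n --> \oo] --> 0.
  rewrite -[X in _ --> X]oppr0; apply: cvgN.
  have [C C0 Cle] := powR_expRN_le p.
  apply: (@squeeze_cvgr _ _ _ _ (cst 0) (fun n => C * expR (- (2^-1 * v n)))).
  - apply: nearW => n; rewrite mulr_ge0 ?powR_ge0 ?expR_ge0//=.
    by rewrite -mulNr Cle// ler1n.
  - exact: cvg_cst.
  - rewrite -[X in _ --> X](mulr0 C); apply: cvgMl_tmp.
    apply: (@cvg_comp _ _ _ v (fun r => expR (- (2^-1 * r)))); first exact: vy.
    apply: (@cvg_comp _ _ _ (fun r => 2^-1 * r) (fun r => expR (- r)) _
      (pinfty_nbhs R)); last exact: cvgr_expR.
    exact: gt0_cvgMry.
have If : mu.-integrable D (EFin \o f) by exact: (integrableB _ i1 ip).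
have f0 : (\int[mu]_(t in D) (f t)%:E = (0 - 0)%:E)%E.
  rewrite -DE; apply: (FTC2_exhaustion f F u v 0 0 uv) => //.
  - by rewrite DE.
  - by rewrite DE.
  - apply: cvg_integral_nondecreasing_set => //.
    + move=> m n mn; rewrite subsetEset; apply: subset_itv; rewrite bnd_simp.
      * by rewrite /u lef_pV2 ?posrE// ler_nat.
      * by rewrite /v ler_nat.
    + by rewrite DE.
have : \int[mu]_(t in D) f t = 0 by rewrite /Rintegral f0 /= subr0.
rewrite /D RintegralB// => /eqP; rewrite subr_eq0 => /eqP.
rewrite RintegralZl// => <-.
by rewrite /Gamma addrK.
Unshelve. all: by end_near. Qed.
End gamma.

(** * Weighted deviation of a Lipschitz function *)

Lemma lipschitz_within_continuous (M : R) (f : R -> R) (A : set R) :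
  0 <= M ->
  (forall u v, A u -> A v -> `|f u - f v| <= M * `|u - v|) ->
  {within A, continuous f}.
Proof.
move=> M0 fL; apply/subspace_continuousP => t At.
apply/cvgrPdist_le => e e0.
have M1 : 0 < M + 1 by rewrite ltr_wpDl.
near=> u; have Au : A u by near: u; exact: withinT.
rewrite (le_trans (fL _ _ At Au))//.
have : `|t - u| <= e / (M + 1).
  by near: u; apply: cvgr_dist_le; [exact: cvg_within|rewrite divr_gt0].
rewrite ler_pdivlMr// => tu.
have := normr_ge0 (t - u); nra.
Unshelve. all: by end_near. Qed.

Lemma integrable_mul_bounded (w f : R -> R) (A : set R) (K : R) :
  measurable A ->
  measurable_fun A f -> (forall t, A t -> `|f t| <= K) ->
  mu.-integrable A (EFin \o w) -> mu.-integrable A (fun t => (w t * f t)%:E).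
Proof.
move=> mA mf fK iw.
have Kreal : K \is Num.real by exact: num_real.
suff : [bounded f t | t in A] by move=> fb; exact: (integrableMl _ iw mf fb).
exists K; split => // r Kr t At.
exact: le_trans (fK t At) (ltW Kr).
Qed.

(** The core estimate. The left-hand side is the absolute value of the integral
    of [w t * ((1 - l) * (f x - f t) + l * (f y - f t))], and the Lipschitz
    bound is integrated pointwise. The number [s] is the common sign of [x - t]
    and [t - y]: [1] if [y, x] are the left and right ends, [-1] if they are the
    right and left ends. *)
Lemma lipschitz_weighted_deviation (M s l c d x y : R) (w f : R -> R) :
  0 <= M -> 0 <= l <= 1 -> c <= x <= d -> c <= y <= d ->
  (forall u v, c <= u <= d -> c <= v <= d -> `|f u - f v| <= M * `|u - v|) ->
  (forall t, c <= t <= d -> `|x - t| = s * (x - t)) ->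
  (forall t, c <= t <= d -> `|y - t| = s * (t - y)) ->
  (forall t, c <= t <= d -> 0 <= w t) ->
  mu.-integrable `[c, d] (EFin \o w) ->
  `|((1 - l) * f x + l * f y) * (\int[mu]_(t in `[c, d]) w t)
    - \int[mu]_(t in `[c, d]) (w t * f t)|
  <= M * (s * ((1 - l) * x - l * y) * (\int[mu]_(t in `[c, d]) w t)
          + s * (2 * l - 1) * (\int[mu]_(t in `[c, d]) (w t * t))).
Proof.
move=> M0 /andP[l0 l1] xcd ycd fL xs ys w0 iw.
have cdP t : `[c, d]%classic t -> c <= t <= d by rewrite /= in_itv.
have mA := measurable_itv `[c, d] : measurable (`[c, d]%classic : set R).
have cd : c <= d by have /andP[/le_trans cx /cx] := xcd.
have ccd : c <= c <= d by rewrite lexx.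
have mf : measurable_fun `[c, d] f.
  apply: subspace_continuous_measurable_fun => //.
  by apply: (lipschitz_within_continuous M) => // u v /cdP ? /cdP ?; exact: fL.
have iwf : mu.-integrable `[c, d] (fun t => (w t * f t)%:E).
  apply: (integrable_mul_bounded w f _ (`|f c| + M * (d - c))) => // t /cdP tcd.
  have -> : f t = f c + (f t - f c) by ring.
  rewrite (le_trans (ler_normD _ _))// lerD2l (le_trans (fL _ _ tcd ccd))//.
  rewrite ler_wpM2l// ger0_norm; last by lra.
  by lra.
have iwt : mu.-integrable `[c, d] (fun t => (w t * t)%:E).
  apply: (integrable_mul_bounded w id _ (`|c| + `|d|)) => // t /cdP tcd.
  have := ler_norm d; have := ler_norm (- c); rewrite normrN.
  have := normr_ge0 c; have := normr_ge0 d.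
  by rewrite ler_norml; lra.
pose k := (1 - l) * f x + l * f y.
pose m := s * ((1 - l) * x - l * y).
have ikw : mu.-integrable `[c, d] (fun t => (k * w t)%:E) by exact: integrableZl iw.
have imw : mu.-integrable `[c, d] (fun t => (m * w t)%:E) by exact: integrableZl iw.
have int : mu.-integrable `[c, d] (fun t => (s * (2 * l - 1) * (w t * t))%:E).
  exact: integrableZl iwt.
have iR : mu.-integrable `[c, d]
    (fun t => (m * w t + s * (2 * l - 1) * (w t * t))%:E).
  exact: (integrableD _ imw int).
have iL : mu.-integrable `[c, d] (fun t => (k * w t - w t * f t)%:E).
  exact: (integrableB _ ikw iwf).
rewrite -/k -/m -(RintegralZl k _ iw)// -(RintegralZl m _ iw)//.
rewrite -(RintegralZl (s * (2 * l - 1)) _ iwt)// -RintegralB// -RintegralD//.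
rewrite -RintegralZl//.
apply: le_trans (le_normr_Rintegral _ iL) _ => //.
apply: le_Rintegral => //.
- exact: integrable_norm.
- exact: integrableZl iR.
move=> t /cdP tcd.
have -> : k * w t - w t * f t = w t * ((1 - l) * (f x - f t) + l * (f y - f t)).
  by rewrite /k; ring.
rewrite normrM ger0_norm ?w0//.
have -> : M * (m * w t + s * (2 * l - 1) * (w t * t))
    = w t * ((1 - l) * (M * `|x - t|) + l * (M * `|y - t|)).
  by rewrite /m xs// ys//; ring.
rewrite ler_wpM2l ?w0// (le_trans (ler_normD _ _))// !normrM.
rewrite (ger0_norm l0) ger0_norm ?subr_ge0//.
by apply: lerD; rewrite ler_wpM2l ?subr_ge0 ?fL.
Qed.

(** * The two halves of the inequality *)

(** The core estimate for the weight [w t = h t / t], rescaled by [al]. The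
    first moment of [w] is the integral of [h], which is how the integrals
    without the factor [1 / t] enter the bound. *)
Lemma fractional_side_bound (M s l al L c d x y : R) (h f : R -> R) :
  0 <= M -> 0 <= l <= 1 -> 0 < al -> 0 < c -> c <= x <= d -> c <= y <= d ->
  (forall u v, c <= u <= d -> c <= v <= d -> `|f u - f v| <= M * `|u - v|) ->
  (forall t, c <= t <= d -> `|x - t| = s * (x - t)) ->
  (forall t, c <= t <= d -> `|y - t| = s * (t - y)) ->
  (forall t, 0 <= h t) ->
  mu.-integrable `[c, d] (fun t => (h t / t)%:E) ->
  al * (\int[mu]_(t in `[c, d]) (h t / t)) = L ->
  `|((1 - l) * f x + l * f y) * L
    - al * \int[mu]_(t in `[c, d]) (h t * f t / t)|
  <= M * (s * ((1 - l) * x - l * y) * L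
          + al * (s * (2 * l - 1)) * (\int[mu]_(t in `[c, d]) h t)).
Proof.
move=> M0 l01 al0 c0 xcd ycd fL xs ys h0 iw <-.
have t_gt0 t : c <= t <= d -> 0 < t by move=> /andP[ct _]; exact: lt_le_trans ct.
have w0 t : c <= t <= d -> 0 <= h t / t.
  by move=> /t_gt0 t0; rewrite divr_ge0// ltW.
have := lipschitz_weighted_deviation M s l c d x y _ f M0 l01 xcd ycd
  fL xs ys w0 iw.
rewrite (@eq_Rintegral _ _ _ mu _ (fun t => h t * f t / t)
  (fun t => h t / t * f t)); last by move=> t _; rewrite mulrAC.
rewrite (@eq_Rintegral _ _ _ mu _ h (fun t => h t / t * t)); last first.
  move=> t /set_mem/=; rewrite in_itv/= => /t_gt0 t0.
  by rewrite divfK// gt_eqF.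
move=> /(ler_wpM2l (ltW al0)); rewrite -{1}(ger0_norm (ltW al0)) -normrM.
by congr (`|_| <= _); ring.
Qed.

(** The contribution of the segment from [a] to [x], with [s = 1] and [y = a]. *)
Lemma fractional_left_bound (M l al a x : R) (f : R -> R) :
  0 <= M -> 0 <= l <= 1 -> 0 < al -> 0 < a -> a <= x ->
  (forall u v, a <= u <= x -> a <= v <= x -> `|f u - f v| <= M * `|u - v|) ->
  `|((1 - l) * f x + l * f a) * ln (x / a) `^ al
    - al * \int[mu]_(t in `[a, x]) (ln (t / a) `^ (al - 1) * f t / t)|
  <= M * (((1 - l) * x - l * a) * ln (x / a) `^ al
          + al * (2 * l - 1) * (\int[mu]_(t in `[a, x]) ln (t / a) `^ (al - 1))).
Proof.
(* If [a = x] both sides vanish, because [0 `^ al = 0]. *)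
move=> M0 l01 al0 a0; rewrite le_eqVlt => /predU1P[<- _|ax fL].
  rewrite set_itv1 !Rintegral_set1 divff ?gt_eqF// ln1 powR0 ?gt_eqF//.
  by rewrite !mulr0 subrr normr0 addr0 mulr0.
have [iw wE] := log_weight_left a x al a0 ax al0.
have := fractional_side_bound M 1 l al _ a x x a
  (fun t => ln (t / a) `^ (al - 1)) f M0 l01 al0 a0 _ _ fL _ _ _ iw wE.
rewrite !mul1r; apply.
- by rewrite lexx ltW.
- by rewrite lexx ltW.
- by move=> t /andP[_ tx]; rewrite mul1r ger0_norm// subr_ge0.
- by move=> t /andP[at_ _]; rewrite mul1r distrC ger0_norm// subr_ge0.
- by move=> t; exact: powR_ge0.
Qed.

(** The contribution of the segment from [x] to [b], with [s = -1] and [y = b]. *)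
Lemma fractional_right_bound (M l al b x : R) (f : R -> R) :
  0 <= M -> 0 <= l <= 1 -> 0 < al -> 0 < x -> x <= b ->
  (forall u v, x <= u <= b -> x <= v <= b -> `|f u - f v| <= M * `|u - v|) ->
  `|((1 - l) * f x + l * f b) * ln (b / x) `^ al
    - al * \int[mu]_(t in `[x, b]) (ln (b / t) `^ (al - 1) * f t / t)|
  <= M * ((l * b - (1 - l) * x) * ln (b / x) `^ al
          + al * (1 - 2 * l) * (\int[mu]_(t in `[x, b]) ln (b / t) `^ (al - 1))).
Proof.
(* If [x = b] both sides vanish, because [0 `^ al = 0]. *)
move=> M0 l01 al0 x0; rewrite le_eqVlt => /predU1P[<- _|xb fL].
  rewrite set_itv1 !Rintegral_set1 divff ?gt_eqF// ln1 powR0 ?gt_eqF//.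
  by rewrite !mulr0 subrr normr0 addr0 mulr0.
have [iw wE] := log_weight_right b x al x0 xb al0.
have := fractional_side_bound M (-1) l al _ x b x b
  (fun t => ln (b / t) `^ (al - 1)) f M0 l01 al0 x0 _ _ fL _ _ _ iw wE.
rewrite !mulN1r !opprB; apply.
- by rewrite lexx ltW.
- by rewrite lexx ltW.
- by move=> t /andP[xt _]; rewrite mulN1r opprB distrC ger0_norm// subr_ge0.
- by move=> t /andP[_ tb]; rewrite mulN1r opprB ger0_norm// subr_ge0.
- by move=> t; exact: powR_ge0.
Qed.

End fractional_bound.

Theorem theorem5 (R : realType) (I : set R) (M : R) (f : R -> R) (a b : R)
    (I_itv : is_interval I) (I_pos : I `<=` `]0, +oo[)
    (M_ge0 : 0 <= M) (f_lip : M.-lipschitz_I f)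
    (Ia : I a) (Ib : I b) (a_lt_b : a < b) :
  forall x lambda alpha : R,
    x \in `[a, b] -> lambda \in `[0, 1] -> 0 < alpha ->
    `|I_ f x lambda alpha a b| <=
      M * (((1 - lambda) * x - lambda * a) * ln (x / a) `^ alpha
           + alpha * (2 * lambda - 1)
             * (\int[lebesgue_measure]_(t in `[a, x]) ln (t / a) `^ (alpha - 1))
           + (lambda * b - (1 - lambda) * x) * ln (b / x) `^ alpha
           + alpha * (1 - 2 * lambda)
             * (\int[lebesgue_measure]_(t in `[x, b]) ln (b / t) `^ (alpha - 1))).
Proof.
move=> x l al; rewrite !in_itv/= => /andP[ax xb] l01 al0.
have a0 : 0 < a by have := I_pos a Ia; rewrite /= in_itv/= andbT.
have Iab t : a <= t <= b -> I t by exact: I_itv.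
have fL u v : a <= u <= b -> a <= v <= b -> `|f u - f v| <= M * `|u - v|.
  by move=> /Iab Iu /Iab Iv; exact: (f_lip (u, v)).
have fLl u v : a <= u <= x -> a <= v <= x -> `|f u - f v| <= M * `|u - v|.
  move=> /andP[au ux] /andP[av vx].
  by apply: fL; apply/andP; split => //; exact: le_trans xb.
have fLr u v : x <= u <= b -> x <= v <= b -> `|f u - f v| <= M * `|u - v|.
  move=> /andP[xu ub] /andP[xv vb].
  by apply: fL; apply/andP; split => //; exact: le_trans ax _.
have x0 := lt_le_trans a0 ax.
have bl := fractional_left_bound M l al a x f M_ge0 l01 al0 a0 ax fLl.
have br := fractional_right_bound M l al b x f M_ge0 l01 al0 x0 xb fLr.
rewrite -addrA mulrDr.
(* Both sides split into a left and a right contribution; the factors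
   [Gamma (alpha + 1)] and [(Gamma alpha)^-1] combine into [alpha]. *)
apply: le_trans (lerD bl br); apply: le_trans (ler_normD _ _).
rewrite le_eqVlt; apply/orP; left; apply/eqP; congr (`|_|).
rewrite /I_ /hadamard_right /hadamard_left GammaD1//.
have G0 : Gamma al != 0 by rewrite gt_eqF// Gamma_gt0.
set Ja := \int[lebesgue_measure]_(t in `[a, x]) (ln (t / a) `^ (al - 1) * f t / t).
set Jb := \int[lebesgue_measure]_(t in `[x, b]) (ln (b / t) `^ (al - 1) * f t / t).
move: Ja Jb => Ja Jb.
move: (Gamma al) (ln (x / a) `^ al) (ln (b / x) `^ al) G0 => g La Lb g0.
by field.
Qed.
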